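(* Let $R=(R,C)$ be a finite based $\mathbb{R}_{\geq 0}$-algebra with basis $C=\{1=c_0,\dots,c_{r-1}\}$, and let $c=a_0c_0+\dots+a_{r-1}c_{r-1}$ with all $a_i\in\mathbb{R}_{\geq 0}$. Let $M(c)$ be the action matrix of $c$, and assume that it satisfies the following Perron--Frobenius condition: $M(c)$ has a leading eigenvalue $\lambda_0=\mathrm{PFdim}\,c\in\mathbb{R}_{>0}$ (that is, $\lambda_0\geq|\mu|$ for all eigenvalues $\mu$ of $M(c)$) of multiplicity one, and there is an integer $h\geq 1$ (the period) such that, with $\zeta=\exp(2\pi i/h)$, the numbers $\lambda_k=\zeta^k\,\mathrm{PFdim}\,c$ for $k\in\{1,\dots,h-1\}$ are precisely the other eigenvalues of $M(c)$ of absolute value $\mathrm{PFdim}\,c$. For $k\in\{0,\dots,h-1\}$ let $v_k$ and $w_k$ be right and left eigenvectors, $M(c)v_k=\lambda_kv_k$ and $w_k^TM(c)=\lambda_kw_k^T$, normalized such that $w_k^Tv_k=1$, and let $v_kw_k^T[1]$ denote the sum of the entries of the first column (the column indexed by $c_0=1$) of the matrix $v_kw_k^T$. Put $$a(n)=\Big(\sum_{k=0}^{h-1}v_kw_k^T[1]\cdot(\zeta^k)^n\Big)\cdot(\mathrm{PFdim}\,c)^n .$$ Then $$b^{R,c}(n)\sim a(n),$$ and the convergence is geometric with ratio $|\lambda^{sec}/\mathrm{PFdim}\,c|$, where $\lambda^{sec}$ is any second largest eigenvalue of $M(c)$. In particular, $$\lim_{n\to\infty}\sqrt[n]{b^{R,c}(n)}=\mathrm{PFdim}\,c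 .$$
   Context: Let $\mathbb{K}\subset\mathbb{C}$ be a unital subring. A finite based $\mathbb{R}_{\geq 0}$-algebra is a (unital, associative) $\mathbb{K}$-algebra $R$ together with a finite $\mathbb{K}$-basis $C=\{1=c_0,\dots,c_{r-1}\}$ containing the unit, such that $c_ic_j=\sum_k m_{i,j}^k c_k$ with all $m_{i,j}^k\in\mathbb{R}_{\geq 0}$. For $c=\sum_i a_ic_i$ with $a_i\in\mathbb{R}_{\geq 0}$, write $c^n=\sum_k m_n^k(c)\,c_k$ and set $b^{R,c}(n)=b_n^{R,c}=\sum_k m_n^k(c)$ (the total sum of the coefficients of $c^n$ in the basis $C$). The pre action matrix of $c$ is the $r\times r$ matrix $M'(c)$ with entries $M'(c)_{k,j}=\sum_i a_im_{i,j}^k$ (so column $j$ contains the coefficients of $c\,c_j$). Its adjacency graph is the weighted oriented graph on the index set with an edge of weight $M'(c)_{k,j}$ from $k$ to $j$ (whenever nonzero). The action matrix $M(c)$ is the submatrix of $M'(c)$ whose rows and columns are indexed by the connected component, in the nonoriented sense, of the vertex $c_0=1$; $c_0$ is kept as the first index. ''Second largest eigenvalue'' $\lambda^{sec}$: an eigenvalue of $M(c)$ of largest absolute value among those of absolute value strictly smaller than $\mathrm{PFdim}\,c$ (take $\lambda^{sec}=0$ if there is none). $f(n)\sim g(n)$ means $f(n)/g(n)\to1$ as $n\to\infty$. A sequence $f(n)$ converges geometrically to $a$ with ratio $\beta\in[0,1)$ if for all $\gamma\in(\beta,1)$ the sequence $(f(n)-a)/\gamma^n$ is bounded; here this is applied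 to $b^{R,c}(n)/a(n)\to 1$ (for $n$ large enough that $a(n)\neq0$). *)

(* Defs.v *)
From HB Require Import structures.
From mathcomp Require Import all_boot all_order all_algebra.
From mathcomp Require Import all_classical all_reals all_analysis.
From mathcomp Require Import complex.

Set Implicit Arguments.
Unset Strict Implicit.
Unset Printing Implicit Defensive.

Import Order.TTheory GRing.Theory Num.Theory.
Import numFieldNormedType.Exports.
Local Open Scope classical_set_scope.
Local Open Scope ring_scope.

(* Throughout, [F] stands for the complex numbers (it is instantiated with
   [R[i]] for [R : realType]); in the order of a [numClosedFieldType],
   [0 <= x] means that [x] is a nonnegative real number.  The unital subring
   is [K], a subtype of [F] whose inclusion [val] is a ring morphism. *)

Record basedAlgebra (F : numClosedFieldType) (S : {pred F})
    (K : subComNzRingType S) := BasedAlgebra {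
  carrier :> algType K;
  rank_pred : nat;
  basis_elt : 'I_rank_pred.+1 -> carrier;
  basis_free : forall a : 'I_rank_pred.+1 -> K,
    \sum_i a i *: basis_elt i = 0 -> forall i, a i = 0;
  basis_span : forall x : carrier,
    exists a : 'I_rank_pred.+1 -> K, x = \sum_i a i *: basis_elt i;
  basis_unit : basis_elt ord0 = 1;
  basis_mul_ge0 : forall i j : 'I_rank_pred.+1,
    exists2 m : 'I_rank_pred.+1 -> K,
      basis_elt i * basis_elt j = \sum_k m k *: basis_elt k
    & forall k, 0 <= val (m k)
}.

Arguments basis_elt {F S K} b _.

Section BasedAlgebra.
Context {F : numClosedFieldType} {S : {pred F}} {K : subComNzRingType S}.
Variable B : basedAlgebra K.

Local Notation r := (rank_pred B).+1.

(* The coordinates are well defined by [basis_free]. *)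
Definition basis_coord (x : B) : 'I_r -> K := sval (cid (basis_span x)).

Definition struct_const (i j k : 'I_r) : K :=
  basis_coord (basis_elt B i * basis_elt B j) k.

Definition total_coef (c : B) (n : nat) : F :=
  \sum_k val (basis_coord (c ^+ n) k).

Definition pre_action_mx (c : B) : 'M[F]_r :=
  \matrix_(k, j) \sum_i val (basis_coord c i) * val (struct_const i j k).

Definition adjacent (c : B) : rel 'I_r :=
  [rel k j | (pre_action_mx c k j != 0) || (pre_action_mx c j k != 0)].

Definition unit_component (c : B) : {set 'I_r} :=
  [set j | connect (adjacent c) ord0 j]%SET.

Lemma unit_in_component (c : B) : ord0 \in unit_component c.
Proof. by rewrite inE connect0. Qed.

Definition action_mx (c : B) : 'M[F]_#|unit_component c| :=
  mxsub enum_val enum_val (pre_action_mx c).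

(* The index of the unit [c_0]; [enum_val] is increasing, so it is the first. *)
Definition unit_index (c : B) : 'I_#|unit_component c| :=
  enum_rank_in (unit_in_component c) ord0.

End BasedAlgebra.

Definition root_of_unity_exp (R : realType) (h : nat) : R[i] :=
  Complex (cos (2 * pi / h%:R)) (sin (2 * pi / h%:R)).

(* Algebraic multiplicity is meant: [lam] is a simple root of [char_poly M]. *)
Definition leading_eigenvalue (F : numClosedFieldType) (m : nat) (M : 'M[F]_m)
    (lam : F) : Prop :=
  [/\ 0 < lam, eigenvalue M lam,
      forall mu, eigenvalue M mu -> `|mu| <= lam
    & mup lam (char_poly M) = 1%N].

Definition perron_frobenius (R : realType) (m : nat) (M : 'M[R[i]]_m)
    (lam : R[i]) (h : nat) : Prop :=
  [/\ leading_eigenvalue M lam, (1 <= h)%N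
    & forall mu : R[i],
        [/\ eigenvalue M mu, `|mu| = lam & mu <> lam] <->
        exists2 k : nat,
          (1 <= k < h)%N & mu = root_of_unity_exp R h ^+ k * lam].

Definition second_largest (F : numClosedFieldType) (m : nat) (M : 'M[F]_m)
    (lam lsec : F) : Prop :=
  [/\ eigenvalue M lsec, `|lsec| < lam
    & forall mu, eigenvalue M mu -> `|mu| < lam -> `|mu| <= `|lsec|]
  \/ (forall mu, eigenvalue M mu -> ~ `|mu| < lam) /\ lsec = 0.

Definition col_sum (F : numClosedFieldType) (m : nat) (A : 'M[F]_m)
    (j : 'I_m) : F := \sum_i A i j.

Definition leading_term (F : numClosedFieldType) (m : nat) (first : 'I_m)
    (zeta lam : F) (h : nat) (v w : 'I_h -> 'cV[F]_m) (n : nat) : F :=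
  (\sum_(k < h) col_sum (v k *m (w k)^T) first * (zeta ^+ k) ^+ n) * lam ^+ n.

(* [f n / g n] is [0] when [g n = 0], so the limit [1] forces [g n != 0] for all
   large [n]. *)
Definition asymptotic (F : numFieldType) (f g : nat -> F) : Prop :=
  f n / g n @[n --> \oo] --> (1 : F).

Definition geometrically_cvg (F : numFieldType) (f : nat -> F) (a beta : F) :
    Prop :=
  0 <= beta < 1 /\
  forall gam, beta < gam < 1 ->
    exists A : F, forall n, `|(f n - a) / gam ^+ n| <= A.

Definition root_limit (F : numClosedFieldType) (f : nat -> F) (l : F) : Prop :=
  n.-root (f n) @[n --> \oo] --> l.

(* Main.v *)
Require Import Defs.
From HB Require Import structures.
From mathcomp Require Import all_boot all_order all_algebra.
From mathcomp Require Import all_classical all_reals all_analysis.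
From mathcomp Require Import complex ring.

Set Implicit Arguments.
Unset Strict Implicit.
Unset Printing Implicit Defensive.

Import Order.TTheory GRing.Theory Num.Theory.
Import numFieldNormedType.Exports.
Local Open Scope ring_scope.

(* Write [lam] for the leading eigenvalue and [b n] for the sum of the
   coefficients of [c ^ n], which is the sum of the first column of [M ^ n].

   The traces of the powers of the nonnegative matrix [M] are nonnegative, and
   averaging [tr (M ^ n) / z ^ n] over [n] recovers the multiplicity of [z] for
   every [z] of modulus [lam].  Hence no peripheral eigenvalue has a larger
   multiplicity than [lam], so all of them are simple, and
   [M ^ n - \sum_k lam_k ^ n v_k w_k^T] is [O(g ^ n)] as soon as [g] exceeds the
   moduli of the remaining eigenvalues.

   As [c ^ n c_j] expands into products [c_i c_j], every entry of [M ^ n] is at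
   most a constant times [b n].  Evaluated on an eigenvector for [lam], this
   gives [b n >= d lam ^ n] with [d > 0], so the error [O(g ^ n)] is
   geometrically small relative to [b n]. *)

(** * Simple eigenvalues, triangularization and traces of powers *)

(* With [P = v w^T] and [c = X - z], the characteristic matrix [X - M] factors as
   [(X - M + (1 - c) P) (1 - (1 - c) P)].  The determinant of the right factor
   vanishes at [z] because of [w], and that of the left one because of [u] unless
   [u = 0]. *)
Lemma simple_eigenvector_eq0 (F : fieldType) n (M : 'M[F]_n) z
    (u v w : 'cV[F]_n) :
  (mup z (char_poly M) <= 1)%N ->
  M *m v = z *: v -> w^T *m M = z *: w^T -> w^T *m v = 1%:M ->
  M *m u = z *: u -> w^T *m u = 0 -> u = 0.
Proof.
move=> mupz Mv wM wv Mu wu; apply/eqP; apply: contraTT mupz => u_neq0.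
have char_neq0 : char_poly M != 0 by rewrite monic_neq0 ?char_poly_monic.
rewrite -ltnNge (mup_geq _ _ char_neq0).
pose c : {poly F} := 'X - z%:P; pose d := 1 - c.
pose P := v *m w^T; pose Q : 'M[{poly F}]_n := map_mx polyC P.
have PP : P *m P = P by rewrite /P mulmxA -(mulmxA v) wv mulmx1.
have MP : M *m P = z *: P by rewrite /P mulmxA Mv scalemxAl.
have NQ : char_poly_mx M *m Q = c *: Q.
  rewrite /char_poly_mx mulmxBl mul_scalar_mx -map_mxM MP map_mxZ.
  by rewrite scalerBl.
have QQ : Q *m Q = Q by rewrite -map_mxM PP.
have factorM : char_poly_mx M = (char_poly_mx M + d *: Q) *m (1%:M - d *: Q).
  rewrite mulmxBr mulmx1 mulmxDl -!scalemxAr -!scalemxAl NQ QQ !scalerA.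
  rewrite -scalerDl -addrA -scalerBl -mulrDr /d addrCA subrr addr0 mulr1.
  by rewrite subrr scale0r addr0.
have evalE (A : 'M[{poly F}]_n) : (\det A).[z] = \det (map_mx (horner_eval z) A).
  by rewrite det_map_mx.
rewrite /char_poly factorM det_mulmx expr2 dvdp_mul // dvdp_XsubCl /root evalE.
- rewrite -det_tr; apply/det0P; exists u^T.
    by apply: contra_neq u_neq0 => /(congr1 trmx); rewrite trmxK trmx0.
  rewrite -trmx_mul; apply/eqP; rewrite -trmx0 (inj_eq trmx_inj); apply/eqP.
  rewrite [X in X *m u](_ : _ = z%:M - M + P); last first.
    apply/matrixP => i j; rewrite !mxE /horner_eval /= /d /c !hornerE.
    by rewrite hornerMn hornerX subrr subr0 mul1r.
  by rewrite mulmxDl mulmxBl mul_scalar_mx Mu subrr add0r /P -mulmxA wu mulmx0.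
- apply/det0P; exists w^T.
    apply: contra_eq_neq wv => ->; rewrite mul0mx eq_sym.
    by apply/eqP => /matrixP /(_ 0 0) /eqP; rewrite !mxE oner_eq0.
  rewrite [X in _ *m X](_ : _ = 1%:M - P).
    by rewrite mulmxBr mulmx1 /P mulmxA wv mul1mx subrr.
  apply/matrixP => i j; rewrite !mxE /horner_eval /= /d /c !hornerE.
  by rewrite hornerMn hornerE subrr subr0 mul1r.
Qed.

Lemma trig_mx_mul (R : pzRingType) n (A B : 'M[R]_n) :
  is_trig_mx A -> is_trig_mx B ->
  is_trig_mx (A *m B) /\ forall i, (A *m B) i i = A i i * B i i.
Proof.
move=> /is_trig_mxP tA /is_trig_mxP tB; split=> [|i].
  apply/is_trig_mxP => i j ltij; rewrite mxE big1 // => k _.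
  have [ltik|leki] := ltnP i k; first by rewrite tA ?mul0r.
  by rewrite tB ?mulr0 // (leq_ltn_trans leki).
rewrite mxE (bigD1 i) //= big1 ?addr0 // => k; rewrite neq_ltn => /orP[] lt.
  by rewrite tB ?mulr0.
by rewrite tA ?mul0r.
Qed.

Lemma trig_mx_exp (R : pzRingType) n (A : 'M[R]_n) k :
  is_trig_mx A ->
  is_trig_mx (A ^+ k) /\ forall i, (A ^+ k) i i = A i i ^+ k.
Proof.
move=> tA; elim: k => [|k [tAk dAk]].
  rewrite expr0; split=> [|i]; last by rewrite expr0 !mxE eqxx.
  by apply/is_trig_mxP => i j ltij; rewrite !mxE -val_eqE ltn_eqF.
rewrite exprS; have [t d] := trig_mx_mul tA tAk; split=> // i.
by rewrite d dAk exprS.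
Qed.

(** By Schur, [M] is similar to a triangular matrix [T]. Similarity preserves both sides, and the
    diagonal of [T ^+ k] consists of the [k]-th powers of the diagonal of [T], which is the list
    [rs]. *)
Lemma mxtrace_exp_roots (F : numClosedFieldType) n (M : 'M[F]_n) :
  exists2 rs : seq F, char_poly M = \prod_(z <- rs) ('X - z%:P)
    & forall k, \tr (M ^+ k) = \sum_(z <- rs) z ^+ k.
Proof.
case: n M => [|n] M.
  exists [::] => [|k]; first by rewrite big_nil /char_poly det_mx00.
  by rewrite big_nil /mxtrace big_ord0.
have [//|P /unitarymx_unit Pu] := Schur M.
rewrite /similar_to conjumx //; set T := P *m M *m invmx P => trigT.
have MT : M = invmx P *m T *m P by rewrite /T !mulmxA mulVmx // mul1mx mulmxKV.
clearbody T.
have powM k : M ^+ k = invmx P *m T ^+ k *m P.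
  elim: k => [|k IHk]; first by rewrite !expr0 mulmx1 mulVmx.
  rewrite !exprS IHk {1}MT -!mulmxE !mulmxA.
  by rewrite -(mulmxA _ P (invmx P)) mulmxV // mulmx1.
exists [seq T i i | i <- enum 'I_n.+1] => [|k]; last first.
  rewrite powM mxtrace_mulC mulmxA mulmxV // mul1mx big_map big_enum.
  by apply: eq_bigr => i _; have [_ ->] := trig_mx_exp k trigT.
rewrite big_map big_enum -char_poly_trig // /char_poly /char_poly_mx.
pose Q := map_mx polyC P; pose Q' := map_mx polyC (invmx P).
have QQ : Q' *m Q = 1%:M by rewrite -map_mxM mulVmx // map_mx1.
rewrite MT !map_mxM -/Q -/Q'.
have -> : 'X%:M - Q' *m map_mx polyC T *m Q
          = Q' *m ('X%:M - map_mx polyC T) *m Q.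
  by rewrite mulmxBr mulmxBl scalar_mxC -(mulmxA _ Q') QQ mulmx1.
by rewrite !det_mulmx mulrAC -det_mulmx QQ det1 mul1r.
Qed.

(** * Nonnegative matrices and multiplicities of peripheral eigenvalues *)

Lemma mulmx_ge0 (R : numDomainType) m n p (A : 'M[R]_(m, n)) (B : 'M[R]_(n, p)) :
  (forall i j, 0 <= A i j) -> (forall i j, 0 <= B i j) ->
  forall i j, 0 <= (A *m B) i j.
Proof. by move=> A0 B0 i j; rewrite mxE sumr_ge0 // => k _; rewrite mulr_ge0. Qed.

Lemma expmx_ge0 (R : numDomainType) n (A : 'M[R]_n) k :
  (forall i j, 0 <= A i j) -> forall i j, 0 <= (A ^+ k) i j.
Proof.
move=> A0; elim: k => [|k IHk]; last by rewrite exprS; apply: mulmx_ge0.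
by move=> i j; rewrite expr0 mxE ler0n.
Qed.

Lemma norm_geometric_sum (F : numFieldType) (x : F) N :
  `|x| <= 1 -> x != 1 -> `|\sum_(i < N) x ^+ i| <= 2 / `|x - 1|.
Proof.
move=> x_le1 x_neq1; have x1 : 0 < `|x - 1| by rewrite normr_gt0 subr_eq0.
rewrite ler_pdivlMr // mulrC -normrM -subrX1.
apply: le_trans (ler_normB _ _) _; rewrite normrX normr1 -[2]/(1 + 1) lerD2r.
by rewrite exprn_ile1.
Qed.

(** Each [mu] in [rs] contributes a geometric sum of ratio [mu / z], of modulus at most 1. It equals
    [N] if [mu = z] and is bounded independently of [N] otherwise. *)
Lemma power_sum_mean (F : numFieldType) (lam z : F) (rs : seq F) :
  0 < lam -> `|z| = lam -> {in rs, forall mu, `|mu| <= lam} ->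
  exists C : F, forall N,
    `|\sum_(k < N) (\sum_(mu <- rs) mu ^+ k) / z ^+ k
      - (N * count_mem z rs)%:R| <= C.
Proof.
move=> lam0 zlam; have z0 : z != 0 by rewrite -normr_gt0 zlam.
elim: rs => [_|mu rs IH rs_le].
  exists 0 => N; rewrite muln0 subr0 big1 ?normr0 // => k _.
  by rewrite big_nil mul0r.
have [|C HC] := IH; first by move=> x xrs; rewrite rs_le // inE xrs orbT.
pose D := if mu == z then 0 else 2 / `|mu / z - 1|.
exists (D + C) => N /=.
under eq_bigr do rewrite big_cons mulrDl -expr_div_n.
rewrite big_split /= mulnDr natrD opprD addrACA.
apply: le_trans (ler_normD _ _) _; apply: lerD (HC N); rewrite /D.
case: eqVneq => [->|mu_z].
  rewrite muln1 divff // (eq_bigr (fun=> 1)) => [|k _]; last by rewrite expr1n.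
  by rewrite sumr_const card_ord subrr normr0.
rewrite muln0 subr0 norm_geometric_sum //.
  by rewrite normf_div zlam ler_pdivrMr // mul1r rs_le ?mem_head.
by apply: contra_neq mu_z => /divr1_eq.
Qed.

(* The mean over [k < N] of [\tr (M ^+ k) / z ^+ k] tends to the multiplicity of
   [z], and it is dominated by the mean for [z = lam] since traces are
   nonnegative. *)
Lemma mup_le_leading (F : numClosedFieldType) n (M : 'M[F]_n) lam z :
  Num.archimedean_axiom F -> (forall i j, 0 <= M i j) -> 0 < lam ->
  (forall mu, eigenvalue M mu -> `|mu| <= lam) -> `|z| = lam ->
  (mup z (char_poly M) <= mup lam (char_poly M))%N.
Proof.
move=> archi M0 lam0 M_le zlam.
have [rs charE trE] := mxtrace_exp_roots M.
have rs_le : {in rs, forall mu, `|mu| <= lam}.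
  by move=> mu; rewrite -root_prod_XsubC -charE -eigenvalue_root_char => /M_le.
have [C HC] := power_sum_mean lam0 zlam rs_le.
have [D HD] := power_sum_mean lam0 (gtr0_norm lam0) rs_le.
rewrite charE !mu_prod_XsubC leqNgt; apply/negP => lt_count.
(* If [z] occurred more often than [lam], the counts would differ by at least 1, and the bounds
   [le_z], [le_sums] and [le_lam] together would give [N <= D + C]. *)
have [N ltN] := archi (D + C); apply/negP: ltN.
have DC0 : 0 <= D + C.
  by rewrite addr_ge0 // ?(le_trans _ (HD 0)) ?(le_trans _ (HC 0)).
rewrite ger0_norm // real_ltNge ?ger0_real // negbK.
have le_sums : `|\sum_(k < N) (\sum_(mu <- rs) mu ^+ k) / z ^+ k|
            <= `|\sum_(k < N) (\sum_(mu <- rs) mu ^+ k) / lam ^+ k|.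
  have tr0 k : 0 <= \sum_(mu <- rs) mu ^+ k.
    by rewrite -trE sumr_ge0 // => i _; apply: expmx_ge0.
  rewrite [leRHS]ger0_norm; last first.
    by rewrite sumr_ge0 // => k _; rewrite divr_ge0 ?tr0 ?exprn_ge0 ?(ltW lam0).
  apply: le_trans (ler_norm_sum _ _ _) _; apply: ler_sum => k _.
  by rewrite normf_div normrX zlam ger0_norm.
have le_z : (N * count_mem z rs)%:R
            <= `|\sum_(k < N) (\sum_(mu <- rs) mu ^+ k) / z ^+ k| + C.
  rewrite -lerBlDl; apply: le_trans (HC N); rewrite distrC.
  by apply: le_trans (lerB_dist _ _); rewrite normr_nat.
have le_lam : `|\sum_(k < N) (\sum_(mu <- rs) mu ^+ k) / lam ^+ k|
            <= D + (N * count_mem lam rs)%:R.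
  rewrite -lerBlDr; apply: le_trans (HD N).
  by apply: le_trans (lerB_dist _ _); rewrite normr_nat.
have := le_trans le_z (lerD (le_trans le_sums le_lam) (lexx C)).
rewrite addrAC -lerBlDr; apply: le_trans; rewrite -natrB ?leq_mul ?(ltnW lt_count) //.
by rewrite ler_nat -mulnBr leq_pmulr // subn_gt0.
Qed.

(** * Spectral expansion of matrix powers with a geometric error *)

Lemma expmx_eigenvector (R : comPzRingType) n (M : 'M[R]_n) z (v : 'cV[R]_n) m :
  M *m v = z *: v -> M ^+ m *m v = z ^+ m *: v.
Proof.
move=> Mv; elim: m => [|m IHm]; first by rewrite !expr0 mul1mx scale1r.
by rewrite exprSr -mulmxE -mulmxA Mv -scalemxAr IHm scalerA -exprS.
Qed.

(** The induction closes for any [D] with [D >= |s 0|] and [|z| D + C <= g D], that is,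
    [D >= C / (g - |z|)]; the sum of the two lower bounds is such a [D]. *)
Lemma affine_recurrence_bound (F : numFieldType) (z g C : F) (s t : nat -> F) :
  `|z| < g -> (forall n, s n.+1 = z * s n + t n) ->
  (forall n, `|t n| <= C * g ^+ n) ->
  exists D, forall n, `|s n| <= D * g ^+ n.
Proof.
move=> zg sE t_le; have g0 : 0 <= g by rewrite (le_trans _ (ltW zg)).
have gz : 0 < g - `|z| by rewrite subr_gt0.
have C0 : 0 <= C by have := t_le 0; rewrite mulr1; apply: le_trans.
pose D := `|s 0| + C / (g - `|z|).
exists D; elim=> [|n IHn]; first by rewrite mulr1 lerDl divr_ge0 // ltW.
rewrite sE; apply: le_trans (ler_normD _ _) _; rewrite normrM.
apply: le_trans (lerD (ler_wpM2l _ IHn) (t_le n)) _ => //.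
rewrite mulrA -mulrDl exprS mulrA ler_wpM2r ?exprn_ge0 //.
rewrite -lerBrDl [_ * D]mulrC -mulrBr /D mulrDl divfK ?gt_eqF // lerDr.
by rewrite mulr_ge0 // ltW.
Qed.

(* Factors [X - z] with [|z| >= g] may be dropped from the annihilating product,
   since the component of [y] along their eigenvector vanishes. *)
Lemma annihilated_power_bound (F : numFieldType) n (M : 'M[F]_n.+1) (g : F)
    (rs : seq F) (y : 'cV[F]_n.+1) :
  {in rs, forall z, `|z| < g \/ exists w : 'cV[F]_n.+1,
    [/\ w^T *m M = z *: w^T, w^T *m y = 0
      & forall u : 'cV[F]_n.+1, M *m u = z *: u -> w^T *m u = 0 -> u = 0]} ->
  horner_mx M (\prod_(z <- rs) ('X - z%:P)) *m y = 0 ->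
  forall i, exists C, forall m, `|(M ^+ m *m y) i 0| <= C * g ^+ m.
Proof.
elim: rs y => [|z rs IH] y rs_cases.
  rewrite big_nil rmorph1 mul1mx => -> i; exists 0 => m.
  by rewrite mulmx0 mxE normr0 mul0r.
rewrite big_cons rmorphM /= rmorphB /= horner_mx_X horner_mx_C => annih i.
set q := horner_mx M _ in annih.
have Mq : M *m q = q *m M by apply/esym/comm_horner_mx.
have stable_case (w : 'cV[F]_n.+1) z' : w^T *m M = z' *: w^T -> w^T *m y = 0 ->
    w^T *m (M *m y) = 0.
  by move=> wM wy; rewrite mulmxA wM -scalemxAl wy scaler0.
have [zg|[w [wM wy w_inj]]] := rs_cases z (mem_head _ _); last first.
  apply: IH => [x xrs|]; first by apply: rs_cases; rewrite inE xrs orbT.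
  (* The vector to kill is [q *m y]. It is annihilated by [M - z], and by [w^T] because [w^T] is a
     left eigenvector of every polynomial in [M]. *)
  apply: w_inj.
    apply/eqP; rewrite -subr_eq0 -mul_scalar_mx -mulmxBl mulmxA.
    exact/eqP.
  have wq (p : {poly F}) : w^T *m horner_mx M p = p.[z] *: w^T.
    elim/poly_ind: p => [|p a IHp]; first by rewrite rmorph0 mulmx0 horner0 scale0r.
    rewrite rmorphD rmorphM /= horner_mx_X horner_mx_C mulmxDr mulmxA IHp.
    by rewrite -scalemxAl wM mul_mx_scalar scalerA -scalerDl !hornerE.
  by rewrite mulmxA wq -scalemxAl wy scaler0.
(* For [|z| < g] the induction hypothesis bounds [M ^+ m *m (M - z) *m y], which is the
   inhomogeneous term of the recurrence with factor [z] satisfied by [M ^+ m *m y]. *)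
have [||C HC] := IH ((M - z%:M) *m y) _ _ i.
- move=> x xrs; have xin : x \in z :: rs by rewrite inE xrs orbT.
  have [?|[w [wM wy w_inj]]] := rs_cases x xin; first by left.
  right; exists w; split=> //.
  by rewrite mulmxBl mulmxBr (stable_case w x) // mul_scalar_mx -scalemxAr wy
    scaler0 subrr.
- rewrite mulmxA mulmxBr -Mq scalar_mxC -mulmxBl.
  exact: annih.
apply: affine_recurrence_bound zg _ HC => m.
rewrite mulmxA mulmxBr exprSr -mulmxE mul_mx_scalar mulmxBl -scalemxAl.
have entryB (A B' : 'cV[F]_n.+1) : (A - z *: B') i 0 = A i 0 - z * B' i 0.
  by rewrite !mxE.
by rewrite entryB addrC subrK.
Qed.

Lemma uniform_geometric_bound (F : numFieldType) (I : finType) (g : F)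
    (f : I -> nat -> F) :
  0 < g -> (forall i, exists C, forall m, `|f i m| <= C * g ^+ m) ->
  exists C, forall i m, `|f i m| <= C * g ^+ m.
Proof.
move=> g0 /fin_all_exists[C HC].
have C0 i : 0 <= C i by have := HC i 0; rewrite mulr1; apply: le_trans.
exists (\sum_i C i) => i m; apply: le_trans (HC i m) _.
rewrite ler_wpM2r ?exprn_ge0 ?(ltW g0) // (bigD1 i) //= lerDl.
by rewrite sumr_ge0.
Qed.

(** Removing from [y] its components along the [v k] leaves a vector [y'] killed by all [w k], since
    the two families are biorthogonal. Cayley-Hamilton supplies a product of linear factors
    annihilating [y']; its peripheral factors are handled by simplicity, the others by [small]. *)
Lemma expmx_spectral_bound (F : numClosedFieldType) n (M : 'M[F]_n) lam h
    (z : 'I_h -> F) (v w : 'I_h -> 'cV[F]_n) g (y : 'cV[F]_n) :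
  Num.archimedean_axiom F -> (forall i j, 0 <= M i j) -> 0 < lam ->
  (forall mu, eigenvalue M mu -> `|mu| <= lam) ->
  (mup lam (char_poly M) <= 1)%N ->
  injective z -> (forall k, `|z k| = lam) ->
  (forall mu, eigenvalue M mu -> `|mu| = lam -> exists k, mu = z k) ->
  (forall k, M *m v k = z k *: v k) ->
  (forall k, (w k)^T *m M = z k *: (w k)^T) ->
  (forall k, (w k)^T *m v k = 1%:M) ->
  0 < g -> (forall mu, eigenvalue M mu -> `|mu| < lam -> `|mu| < g) ->
  exists C, forall i m,
    `|(M ^+ m *m y) i 0 - (\sum_k z k ^+ m *: (v k *m (w k)^T *m y)) i 0|
      <= C * g ^+ m.
Proof.
move=> archi M0 lam0 M_le mup1 z_inj zlam z_surj Mv wM wv g0 small.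
case: n => [|n] in M v w y M0 M_le mup1 z_surj Mv wM wv small *.
  by exists 0 => -[].
have wv0 j k : j != k -> (w j)^T *m v k = 0.
  move=> jk; have /eqP := mulmxA (w j)^T M (v k).
  rewrite Mv wM -scalemxAr -scalemxAl -subr_eq0 -scalerBl scaler_eq0 subr_eq0.
  by rewrite (inj_eq z_inj) eq_sym (negbTE jk) => /eqP.
pose y' := y - \sum_k v k *m (w k)^T *m y.
have wy' j : (w j)^T *m y' = 0.
  rewrite mulmxBr mulmx_sumr (bigD1 j) //= big1 => [|k kj].
    by rewrite addr0 !mulmxA wv mul1mx subrr.
  by rewrite !mulmxA wv0 1?eq_sym // !mul0mx.
have My' m : M ^+ m *m y' =
    M ^+ m *m y - \sum_k z k ^+ m *: (v k *m (w k)^T *m y).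
  rewrite mulmxBr mulmx_sumr; congr (_ - _); apply: eq_bigr => k _.
  by rewrite !mulmxA (expmx_eigenvector m (Mv k)) -!scalemxAl.
have [rs charE _] := mxtrace_exp_roots M.
have bnd i : exists C, forall m, `|(M ^+ m *m y') i 0| <= C * g ^+ m.
  apply: (@annihilated_power_bound _ _ _ _ rs); last first.
    by rewrite -charE Cayley_Hamilton mul0mx.
  move=> mu; rewrite -root_prod_XsubC -charE -eigenvalue_root_char => Mmu.
  have := M_le _ Mmu; rewrite le_eqVlt => /orP[/eqP mulam|]; last by left; apply: small.
  right; have [k muE] := z_surj _ Mmu mulam; exists (w k); split=> // [|u].
    by rewrite muE.
  rewrite muE => Mu wu; apply: simple_eigenvector_eq0 (Mv k) (wM k) (wv k) Mu wu.
  by apply: leq_trans mup1; apply: mup_le_leading.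
have [C HC] := uniform_geometric_bound g0 bnd.
by exists C => i m; have := HC i m; rewrite My' !mxE.
Qed.

(** * Archimedean estimates for geometric sequences *)

Lemma complex_archimedean (R : realType) : Num.archimedean_axiom R[i].
Proof.
move=> z; exists (Num.bound (complex.Re `|z|)).
rewrite -(rmorph_nat (real_complex R)) normc_def ltcR.
exact/archi_boundP/sqrtr_ge0.
Qed.

Lemma bernoulli (R : numDomainType) (x : R) n : 0 <= x -> 1 + x *+ n <= (1 + x) ^+ n.
Proof.
move=> x0; elim: n => [|n IHn]; first by rewrite mulr0n addr0 expr0.
rewrite exprS; apply: le_trans (ler_wpM2l _ IHn); last by rewrite addr_ge0.
rewrite mulrDl mul1r mulrDr mulr1 mulrSr addrA -addrA [x *+ n + x]addrC.
by rewrite -!addrA !lerD2l addrCA lerD2l lerDl mulr_ge0 ?mulrn_wge0.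
Qed.

Lemma expr_lt_eventually (F : numFieldType) (q e : F) :
  Num.archimedean_axiom F -> 0 <= q < 1 -> 0 < e ->
  exists N, forall n, (N <= n)%N -> q ^+ n < e.
Proof.
move=> archi /andP[]; rewrite le_eqVlt => /orP[/eqP<- _|q0 q1] e0.
  (* Since [0 ^+ 0 = 1], the case [q = 0] has to start at exponent 1. *)
  by exists 1%N => -[|n] // _; rewrite expr0n.
have x0 : 0 < q^-1 - 1 by rewrite subr_gt0 invf_gt1.
(* With this [N], the Bernoulli inequality for [q^-1 = 1 + (q^-1 - 1)] gives [q^-1 ^+ n > e^-1]. *)
have [N ltN] := archi (e^-1 / (q^-1 - 1)).
exists N => n leNn; rewrite -[ltRHS]invrK -[ltLHS]invrK ltf_pV2
  ?posrE ?invr_gt0 ?exprn_gt0 //.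
rewrite -exprVn -[in ltRHS](subrK 1 q^-1) [_ - 1 + 1]addrC.
apply: lt_le_trans (bernoulli _ (ltW x0)); apply: ltr_wpDl => //.
rewrite -mulr_natl -ltr_pdivrMr //; apply: lt_le_trans (_ : N%:R <= _).
  by apply: le_lt_trans ltN; rewrite real_ler_norm // ger0_real // divr_ge0
    ?invr_ge0 ?ltW.
by rewrite ler_nat.
Qed.

Lemma spectral_gap (F : numFieldType) (rs : seq F) lam : 0 < lam ->
  exists2 g, 0 < g < lam & {in rs, forall mu, `|mu| < lam -> `|mu| < g}.
Proof.
move=> lam0; elim: rs => [|z rs [g /andP[g0 glam] Hg]].
  by exists (lam / 2) => //; rewrite divr_gt0 // ltr_pdivrMr // ltr_pMr // ltr1n.
have [zlam|] := boolP (`|z| < lam); last first.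
  move=> zlam; exists g; first by rewrite g0.
  move=> mu; rewrite inE => /orP[/eqP->|]; first by rewrite (negbTE zlam).
  exact: Hg.
have g_lt x : x < lam -> x < (x + lam) / 2.
  by move=> xlam; rewrite ltr_pdivlMr // mulr_natr mulr2n ltrD2l.
have g_gt x : x < lam -> (x + lam) / 2 < lam.
  by move=> xlam; rewrite ltr_pdivrMr // mulr_natr mulr2n ltrD2r.
have [zg|gz] := real_ltP (normr_real z) (gtr0_real g0).
  exists g; first by rewrite g0.
  by move=> mu; rewrite inE => /orP[/eqP->|/Hg].
exists ((`|z| + lam) / 2); first by rewrite g_gt // divr_gt0 // ltr_wpDl.
move=> mu; rewrite inE => /orP[/eqP->|murs mulam]; first by move=> _; exact: g_lt.
by apply: lt_le_trans (Hg _ murs mulam) (le_trans gz (ltW (g_lt _ zlam))).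
Qed.

(** * From a lower growth bound to asymptotics and root limits *)

(** A nonzero coordinate of [M ^+ m *m v = lam ^+ m *: v] is bounded through the entries of
    [M ^+ m], hence by a multiple of [b m]. Absolute values are taken because [v] may have complex
    entries. *)
Lemma nonneg_mx_lower_growth (F : numFieldType) n (M : 'M[F]_n) lam D
    (v : 'cV[F]_n) (b : nat -> F) :
  0 < lam -> 0 <= D -> v != 0 -> M *m v = lam *: v ->
  (forall i j m, 0 <= (M ^+ m) i j <= D * b m) ->
  exists2 d, 0 < d & forall m, d * lam ^+ m <= b m.
Proof.
move=> lam0 D0 v0 Mv Mb.
have /matrix0Pn[i [j0]] := v0; rewrite ord1 => {j0} vi0.
pose V := \sum_j `|v j 0|.
have growth m : lam ^+ m * `|v i 0| <= (D * V) * b m.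
  rewrite -[X in X * _]ger0_norm ?exprn_ge0 ?(ltW lam0) // -normrM.
  have -> : lam ^+ m * v i 0 = (M ^+ m *m v) i 0 by rewrite (expmx_eigenvector m Mv) mxE.
  rewrite mxE mulrAC [leRHS]mulr_sumr; apply: le_trans (ler_norm_sum _ _ _) _.
  apply: ler_sum => j _; have /andP[Mm0 MmD] := Mb i j m.
  by rewrite normrM ger0_norm // ler_wpM2r.
have vi : 0 < `|v i 0| by rewrite normr_gt0.
(* Were [D * V] zero, [growth] at exponent 0 would force [v i 0 = 0]. *)
have DV : 0 < D * V.
  rewrite lt0r mulr_ge0 ?sumr_ge0 // andbT; apply: contraTneq (growth 0) => ->.
  by rewrite expr0 mul1r mul0r lt_geF.
exists (`|v i 0| / (D * V)) => [|m]; first by rewrite divr_gt0.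
by rewrite mulrAC ler_pdivrMr // [_ * lam ^+ m]mulrC [b m * _]mulrC.
Qed.

(** The lower bound is known for [b] only. Once the error is below [d / 2 * lam ^+ n], [A] inherits
    it with constant [d / 2], so dividing the error by [A n] is harmless. *)
Lemma ratio_geometric_bound (F : numFieldType) (b A : nat -> F) lam g d C :
  Num.archimedean_axiom F -> 0 < g < lam -> 0 < d ->
  (forall n, d * lam ^+ n <= b n) -> (forall n, `|b n - A n| <= C * g ^+ n) ->
  exists C' N, forall n, (N <= n)%N -> `|b n / A n - 1| <= C' * (g / lam) ^+ n.
Proof.
move=> archi /andP[g0 glam] d0 b_ge bA; have lam0 := lt_trans g0 glam.
have C0 : 0 <= C by have := bA 0; rewrite mulr1; apply: le_trans.
have C1 : 0 < C + 1 by rewrite ltr_wpDl.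
have q01 : 0 <= g / lam < 1.
  by rewrite divr_ge0 ?(ltW g0) ?(ltW lam0) //= ltr_pdivrMr // mul1r.
(* The threshold makes [(C + 1) * g ^+ n] smaller than [d / 2 * lam ^+ n]; [C + 1] replaces [C],
   which may be zero. *)
have [|N HN] := @expr_lt_eventually _ (g / lam) (d / (C + 1) / 2) archi q01.
  by rewrite !divr_gt0.
exists (C / (d / 2)), N => n /HN; rewrite expr_div_n.
rewrite ltr_pdivrMr ?exprn_gt0 // => gn.
have Cgn : C * g ^+ n <= d / 2 * lam ^+ n.
  apply: (@le_trans _ _ ((C + 1) * g ^+ n)).
    by rewrite ler_wpM2r ?exprn_ge0 ?(ltW g0) // lerDl.
  rewrite mulrC -ler_pdivlMr //; apply: le_trans (ltW gn) _.
  by rewrite le_eqVlt; apply/orP; left; apply/eqP; field; rewrite gt_eqF.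
have A_ge : d / 2 * lam ^+ n <= `|A n|.
  have : d * lam ^+ n <= `|A n| + d / 2 * lam ^+ n.
    apply: le_trans (b_ge n) _.
    have b0 : 0 <= b n by apply: le_trans (b_ge n); rewrite mulr_ge0 ?exprn_ge0 ?ltW.
    have := ler_normD (b n - A n) (A n); rewrite subrK ger0_norm // addrC.
    by move/le_trans; apply; rewrite lerD2l; apply: le_trans (bA n) Cgn.
  by rewrite -lerBlDr -mulrBl; congr (_ * _ <= _); field.
have An0 : 0 < `|A n|.
  by apply: lt_le_trans A_ge; rewrite !mulr_gt0 ?invr_gt0 ?exprn_gt0.
have -> : b n / A n - 1 = (b n - A n) / A n.
  by rewrite mulrBl divff // -normr_gt0.
rewrite normf_div ler_pdivrMr //; apply: le_trans (bA n) _.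
rewrite [_ / _ * _]mulrC -!mulrA
  [leRHS](_ : _ = C * g ^+ n * (`|A n| / (d / 2 * lam ^+ n))).
  by rewrite -[leLHS]mulr1 ler_wpM2l ?mulr_ge0 ?exprn_ge0 ?(ltW g0) //
    ler_pdivlMr ?mul1r // mulr_gt0 ?divr_gt0 ?exprn_gt0.
by field; rewrite !gt_eqF ?exprn_gt0.
Qed.

Lemma eventually_bounded (F : numFieldType) (u : nat -> F) C N :
  (forall n, (N <= n)%N -> `|u n| <= C) -> exists C', forall n, `|u n| <= C'.
Proof.
move=> uC; have C0 : 0 <= C by apply: le_trans (uC N (leqnn N)).
exists (\sum_(i < N) `|u i| + C) => n; have [/uC un|ltnN] := leqP N n.
  by apply: le_trans un _; rewrite lerDr sumr_ge0.
rewrite (bigD1 (Ordinal ltnN)) //= -addrA lerDl addr_ge0 // sumr_ge0 //.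
Qed.

Lemma asymptotic_of_geometric (F : numFieldType) (f g : nat -> F) C q N :
  Num.archimedean_axiom F -> 0 < q < 1 ->
  (forall n, (N <= n)%N -> `|f n / g n - 1| <= C * q ^+ n) -> asymptotic f g.
Proof.
move=> archi /andP[q0 q1] fg; apply/cvgrPdist_lt => e e0.
have C0 : 0 <= C.
  by rewrite -(pmulr_lge0 _ (exprn_gt0 N q0)); apply: le_trans (fg N (leqnn N)).
have C1 : 0 < C + 1 by rewrite ltr_wpDl.
have [||N' HN'] := @expr_lt_eventually _ q (e / (C + 1)) archi.
  by rewrite ltW.
  by rewrite divr_gt0.
exists (maxn N N') => // n /=; rewrite geq_max => /andP[/fg fgn /HN' qn].
rewrite distrC; apply: le_lt_trans fgn _.
apply: (@le_lt_trans _ _ ((C + 1) * q ^+ n)).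
  by rewrite ler_wpM2r ?exprn_ge0 ?(ltW q0) // lerDl.
by rewrite mulrC -ltr_pdivlMr.
Qed.

(** For large [n] the constants are absorbed: [(lam - e) ^+ n < d * lam ^+ n] and
    [C * lam ^+ n < (lam + e) ^+ n]. *)
Lemma root_limit_of_bounds (F : numClosedFieldType) (b : nat -> F) lam d C :
  Num.archimedean_axiom F -> 0 < lam -> 0 < d ->
  (forall n, d * lam ^+ n <= b n <= C * lam ^+ n) -> root_limit b lam.
Proof.
move=> archi lam0 d0 bE.
have C0 : 0 < C.
  have /andP[h1 h2] := bE 0%N; move: (le_trans h1 h2); rewrite !mulr1.
  exact: lt_le_trans.
(* Taking roots of [(lam - e) ^+ n] requires [lam - e >= 0]; larger [e] are reduced to [lam / 2]. *)
suff small e : 0 < e -> e < lam ->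
    exists N, forall n, (N <= n)%N -> `|lam - n.-root (b n)| < e.
  apply/cvgrPdist_lt => e e0.
  have [e_lam|lam_e] := real_ltP (gtr0_real e0) (gtr0_real lam0).
    by have [N HN] := small e e0 e_lam; exists N.
  have [||N HN] := small (lam / 2); rewrite ?divr_gt0 //.
    by rewrite ltr_pdivrMr // ltr_pMr // ltr1n.
  exists N => // n /= /HN lt; apply: lt_le_trans lt _; apply: le_trans lam_e.
  by rewrite ler_pdivrMr // ler_pMr // ler1n.
move=> e0 elam.
have q1 : 0 <= (lam - e) / lam < 1.
  by rewrite divr_ge0 ?subr_ge0 ?(ltW lam0) ?(ltW elam) //= ltr_pdivrMr // mul1r gtrBl.
have q2 : 0 <= lam / (lam + e) < 1.
  have le0 : 0 < lam + e by rewrite addr_gt0.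
  by rewrite divr_ge0 ?(ltW lam0) ?(ltW le0) //= ltr_pdivrMr // mul1r ltrDl.
have [N1 HN1] := expr_lt_eventually archi q1 d0.
have [|N2 HN2] := @expr_lt_eventually _ _ (C^-1) archi q2; first by rewrite invr_gt0.
exists (maxn 1 (maxn N1 N2)) => n; rewrite !geq_max => /and3P[n0 /HN1 h1 /HN2 h2].
have /andP[bl bu] := bE n.
have b0 : 0 < b n by apply: lt_le_trans bl; rewrite mulr_gt0 ?exprn_gt0.
have lame : 0 <= lam - e by rewrite subr_ge0 ltW.
rewrite distrC real_ltr_distl; last by rewrite rpredB ?gtr0_real ?rootC_gt0.
apply/andP; split.
  rewrite -[ltLHS](@exprCK _ n) // ltr_rootC ?qualifE/= ?exprn_ge0 ?(ltW b0) //.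
  apply: lt_le_trans bl; rewrite -ltr_pdivrMr ?exprn_gt0 //.
  by rewrite -expr_div_n.
have le0 : 0 < lam + e by rewrite addr_gt0.
rewrite -[ltRHS](@exprCK _ n) ?(ltW le0) // ltr_rootC ?qualifE/=
  ?exprn_ge0 ?(ltW b0) ?(ltW le0) //.
apply: le_lt_trans bu _; rewrite mulrC -ltr_pdivlMr //.
move: h2; rewrite expr_div_n ltr_pdivrMr ?exprn_gt0 //.
by rewrite mulrC.
Qed.

(** * Coordinates in the basis and powers of the action matrix *)

(** Columns indexed by [A] are supported on [A], so [M] is block triangular and the diagonal block
    of a power is the power of the diagonal block. *)
Lemma mxsub_exp (R : pzRingType) n (A : {set 'I_n}) (M : 'M[R]_n) m :
  (forall k j, j \in A -> k \notin A -> M k j = 0) ->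
  (forall k j, j \in A -> k \notin A -> (M ^+ m) k j = 0) /\
  (mxsub enum_val enum_val M : 'M[R]_#|A|) ^+ m = mxsub enum_val enum_val (M ^+ m).
Proof.
move=> M_A; elim: m => [|m [Mm0 IHm]].
  split=> [k j jA kA|].
    by rewrite expr0 mxE; case: eqVneq kA => // ->; rewrite jA.
  by apply/matrixP => i j; rewrite !expr0 !mxE (inj_eq enum_val_inj).
split=> [k j jA kA|].
  rewrite exprS mxE big1 // => i _; have [iA|iA] := boolP (i \in A).
    by rewrite M_A ?mul0r.
  by rewrite Mm0 ?mulr0.
rewrite !exprS IHm; apply/matrixP => i j; rewrite !mxE.
rewrite [RHS](bigID (mem A)) /= [X in _ + X]big1 ?addr0 => [|k kA]; last first.
  by rewrite Mm0 ?mulr0 ?enum_valP.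
by rewrite [RHS]big_enum_val; apply: eq_bigr => k _; rewrite !mxE.
Qed.

Section Coordinates.
Context {F : numClosedFieldType} {S : {pred F}} {K : subComNzRingType S}.
Variable B : basedAlgebra K.
Implicit Types x c : B.

Lemma basis_coordE x : x = \sum_k basis_coord x k *: basis_elt B k.
Proof. by rewrite /basis_coord; case: cid. Qed.

Lemma basis_coord_eq x (a : 'I_(rank_pred B).+1 -> K) :
  x = \sum_k a k *: basis_elt B k -> forall k, basis_coord x k = a k.
Proof.
move=> xE k; apply/eqP; rewrite -subr_eq0; apply/eqP.
apply: (@Defs.basis_free _ _ _ B (fun k => basis_coord x k - a k)).
under eq_bigr do rewrite scalerBl.
by rewrite sumrB -basis_coordE -xE subrr.
Qed.

Lemma basis_coord_sum (I : finType) (a : I -> K) (x : I -> B) k :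
  basis_coord (\sum_i a i *: x i) k = \sum_i a i * basis_coord (x i) k.
Proof.
move: k; apply: basis_coord_eq; under [RHS]eq_bigr do rewrite scaler_suml.
rewrite exchange_big; apply: eq_bigr => i _.
rewrite {1}[x i]basis_coordE scaler_sumr.
by apply: eq_bigr => k _; rewrite scalerA.
Qed.

Lemma pre_action_mxE c k j :
  pre_action_mx c k j = val (basis_coord (c * basis_elt B j) k).
Proof.
rewrite mxE {2}[c]basis_coordE mulr_suml.
under [in RHS]eq_bigr do rewrite -scalerAl.
rewrite basis_coord_sum rmorph_sum /=.
by apply: eq_bigr => i _; rewrite rmorphM.
Qed.

Lemma pre_action_mx_expE c m k j :
  (pre_action_mx c ^+ m) k j = val (basis_coord (c ^+ m * basis_elt B j) k).
Proof.
elim: m k => [|m IHm] k.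
  rewrite !expr0 mul1r mxE (@basis_coord_eq _ (fun i => (i == j)%:R)).
    by rewrite rmorph_nat.
  rewrite (bigD1 j) //= eqxx scale1r big1 ?addr0 // => i /negbTE->.
  by rewrite scale0r.
rewrite !exprS mxE -mulrA [c ^+ m * _]basis_coordE mulr_sumr.
under [in RHS]eq_bigr do rewrite -scalerAr.
rewrite basis_coord_sum rmorph_sum /=; apply: eq_bigr => i _.
by rewrite pre_action_mxE IHm rmorphM mulrC.
Qed.

(** The nonnegative coefficients provided by [basis_mul_ge0] are the structure constants, by
    uniqueness of coordinates. *)
Lemma struct_const_ge0 i j k : 0 <= val (struct_const (B := B) i j k).
Proof.
have [m ijE m0] := @basis_mul_ge0 _ _ _ B i j.
by rewrite /struct_const (basis_coord_eq ijE).
Qed.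

Lemma total_coefE c m :
  total_coef c m = \sum_k (pre_action_mx c ^+ m) k ord0.
Proof.
by apply: eq_bigr => k _; rewrite pre_action_mx_expE basis_unit mulr1.
Qed.

(** A common upper bound for the structure constants; a sum avoids maxima in the partial order of
    [F]. *)
Definition struct_const_sum : F :=
  \sum_i \sum_j \sum_k val (struct_const (B := B) i j k).

Lemma struct_const_le i j k : val (struct_const (B := B) i j k) <= struct_const_sum.
Proof.
have sc0 := struct_const_ge0.
rewrite /struct_const_sum (bigD1 i) //= (bigD1 j) //= (bigD1 k) //= -!addrA lerDl.
by rewrite !addr_ge0 ?sumr_ge0 // => *; rewrite ?sumr_ge0 // => *; rewrite ?sumr_ge0.
Qed.

Section Nonneg.
Variable c : B.
Hypothesis c_ge0 : forall i, 0 <= val (basis_coord c i).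

Lemma pre_action_mx_ge0 k j : 0 <= pre_action_mx c k j.
Proof. by rewrite mxE sumr_ge0 // => i _; rewrite mulr_ge0 ?struct_const_ge0. Qed.

Lemma pre_action_mx_exp_le m k j :
  (pre_action_mx c ^+ m) k j <= struct_const_sum * total_coef c m.
Proof.
have coord0 i : 0 <= val (basis_coord (c ^+ m) i).
  rewrite -[c ^+ m]mulr1 -basis_unit -pre_action_mx_expE.
  exact/expmx_ge0/pre_action_mx_ge0.
rewrite pre_action_mx_expE {1}[c ^+ m]basis_coordE mulr_suml.
under eq_bigr do rewrite -scalerAl.
rewrite basis_coord_sum rmorph_sum mulr_sumr; apply: ler_sum => i _.
rewrite rmorphM mulrC ler_wpM2r ?coord0 //; exact: struct_const_le.
Qed.

End Nonneg.

Lemma pre_action_mx_component c k j :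
  j \in unit_component c -> k \notin unit_component c -> pre_action_mx c k j = 0.
Proof.
rewrite !inE => cj; apply: contraNeq => Mkj.
apply: connect_trans cj (connect1 _).
by rewrite /Defs.adjacent /= Mkj orbT.
Qed.

Lemma action_mx_expE c m i j :
  (action_mx c ^+ m) i j = (pre_action_mx c ^+ m) (enum_val i) (enum_val j).
Proof.
by have [_ ->] := mxsub_exp m (@pre_action_mx_component c); rewrite mxE.
Qed.

(** The column of the unit in a power of the pre action matrix vanishes outside the component of the
    unit, so restricting to that component loses no coefficient of [c ^+ m]. *)
Lemma total_coef_col_sum c m :
  total_coef c m = col_sum (action_mx c ^+ m) (unit_index c).
Proof.
rewrite total_coefE (bigID (mem (unit_component c))) /= [X in _ + X]big1.
  rewrite addr0 big_enum_val; apply: eq_bigr => i _.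
  by rewrite action_mx_expE enum_rankK_in ?unit_in_component.
move=> k kc; have [-> //] := mxsub_exp m (@pre_action_mx_component c).
exact: unit_in_component.
Qed.

End Coordinates.

(** * Asymptotics of the coefficient sums of [c ^+ n] *)

Theorem theorem1 (R : realType) (S : {pred R[i]}) (K : subComNzRingType S)
    (B : basedAlgebra K) (a : 'I_(rank_pred B).+1 -> K) (c : B)
    (PFdim : R[i]) (h : nat)
    (v w : 'I_h -> 'cV[R[i]]_#|unit_component c|) :
  let zeta := root_of_unity_exp R h in
  let M := action_mx c in
  let A := leading_term (unit_index c) zeta PFdim v w in
  (forall i, 0 <= val (a i)) ->
  c = \sum_i a i *: basis_elt B i ->
  perron_frobenius M PFdim h ->
  (forall k : 'I_h, M *m v k = (zeta ^+ k * PFdim) *: v k) ->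
  (forall k : 'I_h, (w k)^T *m M = (zeta ^+ k * PFdim) *: (w k)^T) ->
  (forall k : 'I_h, (w k)^T *m v k = 1%:M) ->
  [/\ asymptotic (total_coef c) A,
      forall lsec : R[i], second_largest M PFdim lsec ->
        geometrically_cvg (fun n => total_coef c n / A n) 1 `|lsec / PFdim|
    & root_limit (total_coef c) PFdim].
Proof.
move=> zeta M A a0 cE [[lam0 lam_eig lam_max mup1] h0 periph] Mv wM wv.
have archi := @complex_archimedean R.
have c0 i : 0 <= val (basis_coord c i) by rewrite (basis_coord_eq cE).
have M0 i j : 0 <= M i j by rewrite mxE pre_action_mx_ge0.
set lam := PFdim in lam0 lam_eig lam_max mup1 periph Mv wM A *.
pose z (k : 'I_h) := zeta ^+ k * lam.
have zlam k : `|z k| = lam.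
  case: k => -[|k] ltkh; rewrite /z /=; first by rewrite expr0 mul1r gtr0_norm.
  by have [|//] := (periph (zeta ^+ k.+1 * lam)).2; exists k.+1.
have z_neq0 k : z k != 0 by rewrite -normr_gt0 zlam.
(* A coincidence [z j = z k] with [j < k] gives [zeta ^+ (k - j) = 1], and then [periph] would list
   [lam] among the eigenvalues different from [lam]. *)
have z_inj : injective z.
  move=> j k; wlog ltjk : j k / (j < k)%N.
    move=> Hwlog zjk; case: (ltngtP j k) => [/Hwlog/(_ zjk)||/val_inj//] //.
    by move/Hwlog => /(_ (esym zjk)).
  rewrite /z => /(mulIf (lt0r_neq0 lam0)) zjk; exfalso.
  have := z_neq0 j; rewrite mulf_eq0 negb_or => /andP[zj0 _].
  have zkj : zeta ^+ (k - j) = 1.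
    by apply: (mulfI zj0); rewrite mulr1 -exprD subnKC ?(ltnW ltjk).
  have [|_ _] := (periph lam).2; last by [].
  exists (k - j)%N; last by rewrite zkj mul1r.
  by rewrite subn_gt0 ltjk (leq_ltn_trans (leq_subr _ _)).
have z_surj mu : eigenvalue M mu -> `|mu| = lam -> exists k, mu = z k.
  move=> Mmu mulam; have [->|/eqP mu_lam] := eqVneq mu lam.
    by exists (Ordinal h0); rewrite /z /= expr0 mul1r.
  have [|k /andP[_ ltkh] ->] := (periph mu).1; first by split.
  by exists (Ordinal ltkh).
have approx g : 0 < g -> (forall mu, eigenvalue M mu -> `|mu| < lam -> `|mu| < g) ->
    exists C, forall m, `|total_coef c m - A m| <= C * g ^+ m.
  (* Applying a matrix to [e] extracts the column of the unit. Summing the coordinates turns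
     [M ^+ m] into [total_coef c m] and the spectral part into [A m]. *)
  move=> g0 small; pose e : 'cV[R[i]]_#|unit_component c| := delta_mx (unit_index c) 0.
  have [|C HC] := @expmx_spectral_bound _ _ M lam _ z v w g e
     archi M0 lam0 lam_max _ z_inj zlam z_surj Mv wM wv g0 small.
    by rewrite mup1.
  exists (\sum_(i < #|unit_component c|) C) => m.
  have -> : total_coef c m - A m = \sum_i ((M ^+ m *m e) i 0 -
      (\sum_k z k ^+ m *: (v k *m (w k)^T *m e)) i 0).
    rewrite sumrB total_coef_col_sum; congr (_ - _).
      by apply: eq_bigr => i _; rewrite -colE mxE.
    rewrite /A /leading_term mulr_suml.
    under [RHS]eq_bigr do rewrite summxE.
    rewrite exchange_big; apply: eq_bigr => k _ /=.
    rewrite -mulrA -exprMn mulr_suml; apply: eq_bigr => i _.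
    by rewrite -colE [RHS]mxE [X in _ = _ * X]mxE mulrC.
  rewrite mulr_suml; apply: le_trans (ler_norm_sum _ _ _) _.
  by apply: ler_sum => i _; apply: HC.
have D0 : 0 <= struct_const_sum B.
  by apply: le_trans (struct_const_le ord0 ord0 ord0); apply: struct_const_ge0.
have [d d0 b_ge] : exists2 d, 0 < d & forall m, d * lam ^+ m <= total_coef c m.
  pose k0 := Ordinal h0.
  apply: (@nonneg_mx_lower_growth _ _ M lam (struct_const_sum B) (v k0)) => //.
  - apply: contra_eq_neq (wv k0) => ->; rewrite mulmx0 eq_sym.
    by apply/eqP => /matrixP /(_ 0 0) /eqP; rewrite !mxE oner_eq0.
  - by rewrite Mv /= expr0 mul1r.
  - move=> i j m; rewrite expmx_ge0 //= action_mx_expE.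
    exact: pre_action_mx_exp_le.
have [rs charE _] := mxtrace_exp_roots M.
have [g glam gap] := spectral_gap rs lam0.
have small mu : eigenvalue M mu -> `|mu| < lam -> `|mu| < g.
  by rewrite eigenvalue_root_char charE root_prod_XsubC; apply: gap.
have [g0 g_lt] := andP glam.
have [C HC] := approx g g0 small.
split.
- have [C' [N HN]] := ratio_geometric_bound archi glam d0 b_ge HC.
  apply: asymptotic_of_geometric HN => //.
  by rewrite divr_gt0 //= ltr_pdivrMr // mul1r.
- move=> lsec lsecP; rewrite normf_div (gtr0_norm lam0).
  have lsec_lt : `|lsec| < lam by case: lsecP => [[]|[_ ->]] //; rewrite normr0.
  split; first by rewrite divr_ge0 ?(ltW lam0) //= ltr_pdivrMr // mul1r.
  move=> gam /andP[gam_gt gam1].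
  have gam0 : 0 < gam by apply: le_lt_trans gam_gt; rewrite divr_ge0 ?(ltW lam0).
  (* The choice [g = gam * lam] makes the ratio [g / lam] equal to [gam], and [gam > |lsec| / lam]
     puts [g] above all eigenvalues of modulus less than [lam]. *)
  have gl : 0 < gam * lam < lam by rewrite mulr_gt0 //= gtr_pMl.
  have [||C' HC'] := approx (gam * lam); first by rewrite mulr_gt0.
    move=> mu Mmu mulam; apply: le_lt_trans (_ : `|lsec| < _); last first.
      by rewrite -ltr_pdivrMr.
    by case: lsecP => [[_ _ /(_ mu Mmu mulam)]|[/(_ mu Mmu)]].
  have [D [N HN]] := ratio_geometric_bound archi gl d0 b_ge HC'.
  (* The finitely many terms before [N], where [A n] may vanish, only enlarge the bound. *)
  apply: (@eventually_bounded _ _ D N) => n /HN.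
  rewrite mulfK ?gt_eqF // => le_n.
  by rewrite normf_div normrX (gtr0_norm gam0) ler_pdivrMr ?exprn_gt0.
(* Both the error, at most [C * g ^+ n] with [g < lam], and [A n], whose peripheral terms have
   modulus [lam ^+ n] up to their coefficients, are absorbed in [E * lam ^+ n]. *)
- pose E := C + \sum_k `|col_sum (v k *m (w k)^T) (unit_index c)|.
  apply: (@root_limit_of_bounds _ _ lam d E archi lam0 d0) => n.
  rewrite b_ge /=.
  have b0 : 0 <= total_coef c n.
    by apply: le_trans (b_ge n); rewrite mulr_ge0 ?exprn_ge0 ?ltW.
  have C0 : 0 <= C by have := HC 0; rewrite mulr1; apply: le_trans.
  rewrite -(ger0_norm b0) -(subrK (A n) (total_coef c n)) /E mulrDl.
  apply: le_trans (ler_normD _ _) (lerD _ _).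
    by apply: le_trans (HC n) _; rewrite ler_wpM2l // lerXn2r ?qualifE/= ?ltW.
  rewrite /A /leading_term mulr_suml mulr_suml.
  apply: le_trans (ler_norm_sum _ _ _) _; apply: ler_sum => k _.
  by rewrite -mulrA -exprMn normrM normrX zlam.
Qed.
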